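(* Let $h:\mathbb{R}^2\to\mathbb{R}$ be positively homogeneous and let $E^*$ be an upper exhauster of $h$ such that $h(u)=\min_{C\in E^*}H(C,u)$ for all $u\in S^1$ (the minimum being attained). Let $C_0\in E^*$, put $\bar E^*=E^*\setminus\{C_0\}$, let $n\ge 1$ be an integer, and let $\mathcal{P}=\{\alpha_0,\alpha_1,\ldots,\alpha_n\}$ be a partition of $[0,2\pi]$ with $0=\alpha_0<\alpha_1<\cdots<\alpha_n=2\pi$. Put $B_j=[\alpha_j,\alpha_{j+1}]$ for $j=0,1,\ldots,n-1$. If for every $j\in\{0,\ldots,n-1\}$ there exists a set $C_j\in\bar E^*$ satisfying $$\rho_{C_j}(\theta)\le\rho_{C_0}(\theta)\quad\text{for all }\theta\in B_j,$$ then $\bar E^*$ is also an upper exhauster of $h$.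
   Context: A function $h:\mathbb{R}^2\to\mathbb{R}$ is positively homogeneous (of degree one) if $h(\lambda g)=\lambda h(g)$ for all $\lambda\ge 0$ and $g\in\mathbb{R}^2$. A family $E^*$ of nonempty, compact, convex subsets of $\mathbb{R}^2$ is an upper exhauster of $h$ if $h(g)=\inf_{C\in E^*}\max_{v\in C}\langle v,g\rangle$ for all $g\in\mathbb{R}^2$. The support function of a nonempty compact convex set $C$ is $H(C,u)=\max_{v\in C}\langle v,u\rangle$; $S^1$ is the set of unit vectors of $\mathbb{R}^2$. For $\theta\in[0,2\pi]$ put $u_\theta=(\cos\theta,\sin\theta)$ and $\rho_C(\theta)=H(C,u_\theta)=\max_{v\in C}\langle v,u_\theta\rangle$. *)

(* Defs.v *)
From mathcomp Require Import all_boot all_order all_algebra.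
From mathcomp Require Import all_classical all_reals all_analysis.

Set Implicit Arguments.
Unset Strict Implicit.
Unset Printing Implicit Defensive.

Import Order.TTheory GRing.Theory Num.Theory.
Import numFieldNormedType.Exports.

Local Open Scope classical_set_scope.
Local Open Scope ring_scope.

(* The norm carried by ['rV[R]_2] in the library is the sup norm. It induces
   the usual topology, hence the usual compact sets, but Euclidean lengths have
   to be computed from [dotv]. *)

Definition dotv (R : realType) (v w : 'rV[R]_2) : R := \sum_i v 0 i * w 0 i.

Definition unit_circle (R : realType) : set 'rV[R]_2 :=
  [set u | Num.sqrt (dotv u u) = 1].

Definition pos_homogeneous (R : realType) (h : 'rV[R]_2 -> R) : Prop :=
  forall (lam : R) (g : 'rV[R]_2), 0 <= lam -> h (lam *: g) = lam * h g.

(* A [sup] in place of a maximum: the two agree for the nonempty compact sets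
   it is used on, see [support_fun_max]. *)
Definition support_fun (R : realType) (C : set 'rV[R]_2) (u : 'rV[R]_2) : R :=
  sup [set dotv v u | v in C].

Definition is_max (R : realType) (A : set R) (m : R) : Prop :=
  A m /\ ubound A m.

Definition is_min (R : realType) (A : set R) (m : R) : Prop :=
  A m /\ lbound A m.

(* The infimum is taken in the extended reals, so that the equation forces the
   set of values to be nonempty and bounded below ([inf] on reals would return
   the default value 0 otherwise). *)
Definition upper_exhauster (R : realType) (h : 'rV[R]_2 -> R)
    (E : set (set 'rV[R]_2)) : Prop :=
  (forall C, E C -> [/\ C !=set0, compact C & convex_set C]) /\
  (forall g, (h g)%:E = ereal_inf [set (support_fun C g)%:E | C in E]).

Definition circle_pt (R : realType) (theta : R) : 'rV[R]_2 :=
  \row_(i < 2) (if i == 0 then cos theta else sin theta).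

Definition rho (R : realType) (C : set 'rV[R]_2) (theta : R) : R :=
  support_fun C (circle_pt theta).

Lemma dotv_continuous (R : realType) (u : 'rV[R]_2) :
  continuous (fun v : 'rV[R]_2 => dotv v u).
Proof.
move=> x; have coordM i : {for x, continuous (fun v : 'rV[R]_2 => v 0 i * u 0 i)}.
  have cvi : {for x, continuous (fun v : 'rV[R]_2 => v 0 i)}.
    exact: coord_continuous.
  have cui : {for x, continuous (fun=> u 0 i : R)} by exact: cst_continuous.
  exact: (continuousM cvi cui).
have -> : (fun v : 'rV[R]_2 => dotv v u) = (fun v : 'rV[R]_2 => v 0 ord0 * u 0 ord0) +
    (fun v => v 0 (lift ord0 ord0) * u 0 (lift ord0 ord0)).
  by apply/funext => v; rewrite /dotv big_ord_recl big_ord1.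
exact: (continuousD (coordM _) (coordM _)).
Qed.

Lemma support_fun_max (R : realType) (C : set 'rV[R]_2) (u : 'rV[R]_2) :
  C !=set0 -> compact C -> is_max [set dotv v u | v in C] (support_fun C u).
Proof.
move=> C0 cC.
have [v Cv vmax] : exists2 v, C v & forall w, C w -> dotv w u <= dotv v u.
  have := @compact_EVT_max _ _ (fun v => dotv v u) C C0 cC.
  case; first exact/continuous_subspaceT/dotv_continuous.
  by move=> v /set_mem Cv vmax; exists v => // w Cw; apply/vmax/mem_set.
have ubv : ubound [set dotv w u | w in C] (dotv v u).
  by move=> _ [w Cw <-]; exact: vmax.
have -> : support_fun C u = dotv v u.
  apply/eqP; rewrite eq_le; apply/andP; split.
    by apply: ge_sup => //; exists (dotv v u), v.
  by apply: ub_le_sup; [exists (dotv v u) | exists v].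
by split => //; exists v.
Qed.

(* Main.v *)
Require Import Defs.
From mathcomp Require Import all_boot all_order all_algebra.
From mathcomp Require Import all_classical all_reals all_analysis.
From mathcomp Require Import ring lra.
Import Order.TTheory GRing.Theory Num.Theory.
Import numFieldNormedType.Exports.
Local Open Scope classical_set_scope.
Local Open Scope ring_scope.

(** Removing [C0] from [E] can only raise the infimum of the support values, and
    it does not raise it if in each direction [g] some other member of [E] has
    a support value at most that of [C0] ([upper_exhauster_setD1]). Support
    functions are positively homogeneous, so a domination at a point of the
    circle spreads along the whole ray through it ([support_funZ]). Every [g]
    lies on the ray through a circle point whose angle is between 0 and 2 pi
    ([polar_form]); that angle belongs to one of the arcs of the partition
    ([partition_locate]), and on that arc the hypothesis provides the
    dominating set. *)

Lemma dotvZr (R : realType) (v u : 'rV[R]_2) (r : R) :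
  dotv v (r *: u) = r * dotv v u.
Proof.
by rewrite /dotv mulr_sumr; apply: eq_bigr => i _; rewrite mxE mulrCA.
Qed.

(** Scaling the direction by [r >= 0] does not change which points of [C]
    maximise the linear form. *)
Lemma support_funZ (R : realType) (C : set 'rV[R]_2) (u : 'rV[R]_2) (r : R) :
  C !=set0 -> compact C -> 0 <= r ->
  support_fun C (r *: u) = r * support_fun C u.
Proof.
move=> CN0 cC r0.
have [[v Cv <-] vmax] := support_fun_max u CN0 cC.
have [[w Cw <-] wmax] := support_fun_max (r *: u) CN0 cC.
apply/eqP; rewrite eq_le; apply/andP; split.
  by rewrite dotvZr ler_wpM2l //; apply: vmax; exists w.
by rewrite -dotvZr; apply: wmax; exists v.
Qed.

(** The arccosine parametrises the upper half circle by angles from 0 to pi;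
    the reflection [t |-> 2 pi - t] carries it to the lower half. *)
Lemma unit_angle (R : realType) (x y : R) : x ^+ 2 + y ^+ 2 = 1 ->
  exists2 t : R, t \in `[0, 2 * pi] & cos t = x /\ sin t = y.
Proof.
move=> xy1.
have x11 : -1 <= x <= 1 by apply/andP; split; nra.
have sx : sin (acos x) = `|y|.
  by rewrite sin_acos // -xy1 addrC addKr sqrtr_sqr.
have cx : cos (acos x) = x by rewrite acosK ?in_itv.
have a0 := acos_ge0 x11; have api := acos_lepi x11.
have [y0|y0] := leP 0 y.
  exists (acos x); first by rewrite in_itv /=; apply/andP; split; lra.
  by rewrite sx ger0_norm.
exists (2 * pi - acos x).
  by rewrite in_itv /=; apply/andP; split; lra.
rewrite mulr_natl [_ - _]addrC cosD2pi sinD2pi cosN sinN cx sx.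
by rewrite ltr0_norm // opprK.
Qed.

Lemma polar_form (R : realType) (g : 'rV[R]_2) :
  exists r t : R,
    [/\ 0 <= r, t \in `[0, 2 * pi] & g = r *: circle_pt t].
Proof.
set x := g 0 ord0; set y := g 0 (lift ord0 ord0).
pose r := Num.sqrt (x ^+ 2 + y ^+ 2).
have n0 : 0 <= x ^+ 2 + y ^+ 2 by rewrite addr_ge0 ?sqr_ge0.
have r2 : r ^+ 2 = x ^+ 2 + y ^+ 2 by rewrite sqr_sqrtr.
have r0 : 0 <= r by exact: sqrtr_ge0.
suff [t t2pi [xt yt]] : exists2 t : R, t \in `[0, 2 * pi] &
    x = r * cos t /\ y = r * sin t.
  exists r, t; split => //; apply/rowP => i; rewrite !mxE.
  by case: (unliftP ord0 i) => [j|] -> //; rewrite (ord1 j).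
have [rz|rN0] := eqVneq r 0.
  (* At the origin the angle is arbitrary. *)
  exists 0; first by rewrite in_itv /= lexx mulr_ge0 ?pi_ge0.
  by rewrite rz !mul0r; move: r2; rewrite rz; split; nra.
have [|t t2pi [ct st]] := unit_angle _ (x / r) (y / r).
  by rewrite !expr_div_n -mulrDl -r2 divff // expf_neq0.
by exists t => //; rewrite ct st ![r * _]mulrC !divfK.
Qed.

Lemma partition_locate (R : realDomainType) (a : nat -> R) (n : nat) (t : R) :
  (0 < n)%N -> t \in `[a 0%N, a n] ->
  exists2 j : nat, (j < n)%N & t \in `[a j, a j.+1].
Proof.
case: n => // n _; elim: n => [|n IHn]; first by exists 0%N.
rewrite in_itv /= => /andP[at0 tan].
have [ta|ta] := leP t (a n.+1).
  have [|j jn tj] := IHn; first by rewrite in_itv /= at0.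
  by exists j => //; exact: ltnW.
by exists n.+1 => //; rewrite in_itv /= (ltW ta).
Qed.

(** Each value that [C0] contributes to the infimum is bounded below by a value
    of a remaining set. The dominating set may depend on the direction, since
    the infimum is taken separately for each [g]. *)
Lemma upper_exhauster_setD1 (R : realType) (h : 'rV[R]_2 -> R)
    (E : set (set 'rV[R]_2)) (C0 : set 'rV[R]_2) :
  upper_exhauster h E ->
  (forall g, exists2 C, (E `\ C0) C & support_fun C g <= support_fun C0 g) ->
  upper_exhauster h (E `\ C0).
Proof.
move=> [convE hE] dom; split => [C [/convE]|g] //.
rewrite hE; apply/eqP; rewrite eq_le; apply/andP; split.
  by apply: ereal_inf_le_tmp => _ [C [EC _] <-]; exists C.
apply: le_ereal_inf_tmp => _ [C EC <-]; apply: ge_ereal_inf.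
have [CC0|CC0] := pselect (C = C0); last by exists (support_fun C g)%:E => //; exists C.
have [D ED Dle] := dom g; exists (support_fun D g)%:E; first by exists D.
by rewrite lee_fin CC0.
Qed.

Theorem corollary3 (R : realType) (h : 'rV[R]_2 -> R)
    (E : set (set 'rV[R]_2)) (C0 : set 'rV[R]_2) (n : nat) (alpha : nat -> R)
    (hom_h : pos_homogeneous h)
    (exh_E : upper_exhauster h E)
    (min_E : forall u, unit_circle u ->
       is_min [set support_fun C u | C in E] (h u))
    (E_C0 : E C0)
    (n_ge1 : (1 <= n)%N)
    (alpha0 : alpha 0%N = 0)
    (alphan : alpha n = 2 * pi)
    (alpha_lt : forall j : nat, (j < n)%N -> alpha j < alpha j.+1)
    (cover : forall j : nat, (j < n)%N ->
       exists2 C : set 'rV[R]_2, (E `\ C0) C &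
         forall theta : R, theta \in `[alpha j, alpha j.+1] ->
           rho C theta <= rho C0 theta) :
  upper_exhauster h (E `\ C0).
Proof.
apply: (upper_exhauster_setD1 _ _ _ _ exh_E) => g.
have [convE _] := exh_E.
have [r [t [r0 t2pi ->]]] := polar_form _ g.
have [|j jn tj] := partition_locate _ alpha n t n_ge1.
  by rewrite alpha0 alphan.
have [C EC Cle] := cover j jn; exists C => //.
have [CN0 cC _] := convE C EC.1.
have [C0N0 cC0 _] := convE C0 E_C0.
by rewrite !support_funZ // ler_wpM2l //; exact: Cle.
Qed.
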